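(* Algorithm 1 is a factor-$3$ approximation algorithm for $1|(a,L_j,b)|\sum C_j$. That is, Algorithm 1 runs in polynomial time, and for every instance with $a_j=a$ and $b_j=b$ for all jobs $j$ and arbitrary delays $L_j$, it outputs a feasible schedule whose sum of completion times is at most $3$ times the minimum sum of completion times over all feasible schedules.
   Context: Coupled task scheduling on a single machine: each job $j\in\{1,\dots,n\}$ has a first task of processing time $a_j>0$, a second task of processing time $b_j>0$, and a delay time $L_j\ge 0$. A feasible schedule assigns a starting time $S_j\ge 0$ to each job $j$; the first task occupies $[S_j,S_j+a_j]$, the second task occupies $[S_j+a_j+L_j,\,S_j+a_j+L_j+b_j]$ (the delay is exact, no preemption), and no two of the $2n$ tasks overlap (their intervals have disjoint interiors). Other tasks may be processed during the delay of a job. The completion time of $j$ is $C_j=S_j+a_j+L_j+b_j$, and the objective is to minimize $\sum_{j=1}^n C_j$. Algorithm 1. Input: an instance with $a_j=a$, $b_j=b$ for all $j$. Step 1: sort the jobs in non-decreasing order of $L_j$ and re-index them in this order. Step 2: for $j=1,\dots,n$ in this order, schedule job $j$ as soon as possible with respect to the partial schedule of jobs $1,\dots,j-1$, i.e. set $S_j:=\min\{t\ge 0:\text{ the machine is idle both in }[t,t+a_j]\text{ and in }[t+a_j+L_j,\,t+a_j+L_j+b_j]\}$ (idle meaning that no already scheduled task overlaps the interior of the interval). *)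

(* Defs.v *)
From HB Require Import structures.
From mathcomp Require Import all_boot all_order all_algebra all_fingroup.

Set Implicit Arguments.
Unset Strict Implicit.
Unset Printing Implicit Defensive.

Import Order.TTheory GRing.Theory Num.Theory.
Local Open Scope ring_scope.

Record instance (R : realFieldType) (n : nat) := Instance {
  fst_time : 'I_n -> R;
  snd_time : 'I_n -> R;
  delay : 'I_n -> R
}.

Definition well_formed R n (I : instance R n) :=
  forall j, [/\ 0 < fst_time I j, 0 < snd_time I j & 0 <= delay I j].

(* The instances of 1|(a, L_j, b)|sum C_j. *)
Definition uniform_instance (R : realFieldType) n (a b : R) (L : 'I_n -> R) :=
  Instance (fun=> a) (fun=> b) L.

Section Schedules.
Variables (R : realFieldType) (n : nat) (I : instance R n).

(* Interior of the time interval occupied by the first ([c = false]) or second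
   ([c = true]) task of job [j] when [j] starts at time [t]. *)
Definition task (j : 'I_n) (c : bool) (t : R) : interval R :=
  let u := t + fst_time I j in
  let v := u + delay I j in
  if c then `]v, v + snd_time I j[ else `]t, u[.

Definition disjoint_itv (A B : interval R) := forall x, ~ (x \in A /\ x \in B).

Definition feasible (S : 'I_n -> R) :=
  (forall j, 0 <= S j) /\
  (forall i c j d, (i, c) != (j, d) ->
     disjoint_itv (task i c (S i)) (task j d (S j))).

Definition completion (S : 'I_n -> R) (j : 'I_n) :=
  S j + fst_time I j + delay I j + snd_time I j.

Definition sum_completion (S : 'I_n -> R) := \sum_j completion S j.

(* With the jobs of [P] started as prescribed by [S], the machine is idle
   during both tasks of [j] if [j] is started at [t]. *)
Definition idle_for (P : pred 'I_n) (S : 'I_n -> R) (j : 'I_n) (t : R) :=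
  forall i, P i -> forall c d, disjoint_itv (task j c t) (task i d (S i)).

Definition earliest_start (P : pred 'I_n) (S : 'I_n -> R) (j : 'I_n) (t : R) :=
  [/\ 0 <= t, idle_for P S j t
    & forall u, 0 <= u -> idle_for P S j u -> t <= u].

(* [s k] is the job at position [k] in the sorted order.  The order of jobs
   with equal delays is left open, so the algorithm is a relation between
   instances and schedules; [S] is indexed by the original job names. *)
Definition algorithm1 (S : 'I_n -> R) :=
  exists s : {perm 'I_n},
    (forall i j : 'I_n, (i <= j)%N -> delay I (s i) <= delay I (s j)) /\
    (forall k : 'I_n,
       earliest_start [pred i | (s^-1%g i < k)%N] S (s k) (S (s k))).

End Schedules.

(* A random access machine with logarithmic costs, which defines polynomial
   time.  It works on rational numbers.  It has registers, which a program
   names by constants, and a memory with indirect addressing.  It can add,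
   subtract and compare; there is no multiplication. *)

Inductive expr :=
| Const of int
| Reg of nat
| Fetch of expr
| Add of expr & expr
| Sub of expr & expr.

Inductive test :=
| Le of expr & expr
| Lt of expr & expr.

Inductive cmd :=
| Skip
| SetReg of nat & expr
| Store of expr & expr
| Seq of cmd & cmd
| If of test & cmd & cmd
| While of test & cmd.

Record state := State { reg : nat -> rat; mem : nat -> rat }.

Definition update (f : nat -> rat) (k : nat) (x : rat) : nat -> rat :=
  fun i => if i == k then x else f i.

(* Only addresses in nat are meant to be used, and then [address k%:R = k]; the
   value elsewhere is a convention making evaluation total. *)
Definition address (x : rat) : nat := `|numq x|%N.

Definition bitlen (m : nat) : nat := (trunc_log 2 m).+1.

Definition rat_size (x : rat) : nat :=
  (bitlen `|numq x| + bitlen `|denq x|)%N.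

Fixpoint eval (st : state) (e : expr) : rat :=
  match e with
  | Const z => z%:~R
  | Reg r => reg st r
  | Fetch e => mem st (address (eval st e))
  | Add e f => eval st e + eval st f
  | Sub e f => eval st e - eval st f
  end.

(* Every operation is charged the bit sizes of its operands (an address being
   the operand of [Fetch]) and of its result. *)
Fixpoint eval_cost (st : state) (e : expr) : nat :=
  (1 + rat_size (eval st e) +
   match e with
   | Const _ | Reg _ => 0
   | Fetch e => eval_cost st e
   | Add e f | Sub e f => eval_cost st e + eval_cost st f
   end)%N.

Definition eval_test (st : state) (b : test) : bool :=
  match b with
  | Le e f => eval st e <= eval st f
  | Lt e f => eval st e < eval st f
  end.

Definition test_cost (st : state) (b : test) : nat :=
  match b with Le e f | Lt e f => (1 + eval_cost st e + eval_cost st f)%N end.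

(* [run c st st' t]: started in [st], [c] halts in [st'] at total cost [t]. *)
Inductive run : cmd -> state -> state -> nat -> Prop :=
| RunSkip st : run Skip st st 1
| RunSetReg st r e :
    run (SetReg r e) st (State (update (reg st) r (eval st e)) (mem st))
        (1 + eval_cost st e)
| RunStore st e f :
    run (Store e f) st
        (State (reg st) (update (mem st) (address (eval st e)) (eval st f)))
        (1 + eval_cost st e + eval_cost st f)
| RunSeq c d st st' st'' t u :
    run c st st' t -> run d st' st'' u -> run (Seq c d) st st'' (t + u)
| RunIf b c d st st' t :
    run (if eval_test st b then c else d) st st' t ->
    run (If b c d) st st' (test_cost st b + t)
| RunWhileFalse b c st :
    ~~ eval_test st b -> run (While b c) st st (test_cost st b)
| RunWhileTrue b c st st' st'' t u :
    eval_test st b -> run c st st' t -> run (While b c) st' st'' u ->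
    run (While b c) st st'' (test_cost st b + t + u).

Definition encode n (a b : rat) (L : 'I_n -> rat) : seq rat :=
  [:: n%:R, a, b & [seq L j | j <- enum 'I_n]].

Definition input_size n (a b : rat) (L : 'I_n -> rat) : nat :=
  (\sum_(x <- encode a b L) rat_size x)%N.

(* The input fills the first memory cells; everything else is zero. *)
Definition initial_state n (a b : rat) (L : 'I_n -> rat) : state :=
  State (fun=> 0) (nth 0 (encode a b L)).

(* The schedule is output in the first memory cells. *)
Definition output n (st : state) : 'I_n -> rat := fun j => mem st j.

(* Main.v *)
(** If job [j] cannot start at [t] in the partial schedule, some already placed job [i] blocks it.
    Either [S i > t], and then [t] was already blocked when [i] was placed, or [S i <= t], and then
    [L i <= L j] forces [t] to lie in one of two intervals of length [a + b] attached to [i].  Hence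
    the [k]-th job (counted from 0) starts no later than [2 * k * (a + b)].  In any schedule the
    [k]-th completion time is at least [(k + 1) * (a + b)] and each job takes [a + b + L j], so the
    sum of the completion times is at most [2 + 1] times the optimum.

    The algorithm is run by a program that looks for the earliest start of a job by jumping to the
    right end of any blocked interval containing the current candidate.  It makes cubically many
    steps, and since it only adds and subtracts, the bit sizes grow linearly with the number of
    steps. *)

Require Import Defs.
From mathcomp Require Import all_boot all_order all_algebra all_fingroup.
From mathcomp Require Import ring lra zify.
Set Implicit Arguments.
Unset Strict Implicit.
Unset Printing Implicit Defensive.

Import Order.TTheory GRing.Theory Num.Theory.
Local Open Scope ring_scope.
Local Notation memory := Defs.mem.

(** * Covering and packing by intervals *)

Section Intervals.
Variable R : realFieldType.
Implicit Types (p q r s d lo hi : R).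

Lemma disjoint_itvP p q r s : p < q -> r < s ->
  disjoint_itv (`]p, q[) (`]r, s[) <-> ~~ ((p < s) && (r < q)).
Proof.
move=> pq rs; split=> [dis|]; last first.
  move=> /negP dis x []; rewrite !in_itv /= => /andP[px xq] /andP[rx xs].
  by apply: dis; rewrite (lt_trans px xs) (lt_trans rx xq).
apply/negP => /andP[ps rq].
pose l := Num.max p r; pose h := Num.min q s.
have lh : l < h by rewrite /l /h gt_max !lt_min pq ps rq rs.
apply: (dis ((l + h) / 2)).
have [/andP[lp lr] /andP[hq hs]] : (p <= l) && (r <= l) /\ (h <= q) && (h <= s).
  by rewrite /l /h !le_max !ge_min !lexx !orbT.
by rewrite !in_itv /=; split; apply/andP; split; lra.
Qed.

(** The point [x] lies in some [[l, l + d)]. Once that interval is dropped, the others must cover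
    everything from [l + d] to [y], so each interval pays for length at most [d]. *)
Lemma covering_bound (ls : seq R) d (x y : R) : 0 <= d ->
  (forall t, x <= t < y -> exists2 l, l \in ls & l <= t < l + d) ->
  y - x <= (size ls)%:R * d.
Proof.
move=> d0; have [m] := ubnP (size ls); elim: m ls x => // m IH ls x lsm cov.
have [yx|xy] := leP y x.
  have : 0 <= (size ls)%:R * d by rewrite mulr_ge0.
  lra.
have [|l lls /andP[lx xl]] := cov x; first by rewrite lexx.
have sl : size ls = (size (rem l ls)).+1.
  by rewrite size_rem // prednK //; case: (ls) lls.
have := IH (rem l ls) (l + d); rewrite sl in lsm *; move=> /(_ lsm) IHl.
suff : y - (l + d) <= (size (rem l ls))%:R * d by rewrite -natr1; lra.
apply: IHl => t /andP[ldt ty]; case: (cov t) => [|l' l's /andP[l't tl']].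
  by apply/andP; split; lra.
exists l'; last by rewrite l't tl'.
have: l' != l by apply/eqP => E; move: tl'; rewrite E; lra.
have /perm_mem/(_ l') := perm_to_rem lls; rewrite l's inE => /esym/orP[/eqP->|//].
by rewrite eqxx.
Qed.

(** Remove one interval [x]: all others lie in [[lo, l x]] or in [[r x, hi]], and induction on the
    cardinality applies to both groups. *)
Lemma packing_bound (J : finType) (A : {set J}) (l r : J -> R) lo hi :
  lo <= hi -> {in A, forall x, [/\ lo <= l x, l x < r x & r x <= hi]} ->
  {in A &, forall x y, x != y -> (r x <= l y) || (r y <= l x)} ->
  \sum_(x in A) (r x - l x) <= hi - lo.
Proof.
have [m] := ubnP #|A|; elim: m A lo hi => // m IH A lo hi Am lohi bnd dis.
have [->|[x xA]] := set_0Vmem A; first by rewrite big_set0 subr_ge0.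
rewrite (big_setD1 x) //= (big_setID [set y | r y <= l x]) /=.
have [lox lrx rhi] := bnd _ xA.
have small (B : {set J}) : B \subset A :\ x -> (#|B| < m)%N.
  move=> /subset_leq_card; move: Am; rewrite (cardsD1 x) xA; lia.
have sub1 : (A :\ x) :&: [set y | r y <= l x] \subset A :\ x by apply: subsetIl.
have sub2 : (A :\ x) :\: [set y | r y <= l x] \subset A :\ x by apply: subsetDl.
have AxA : A :\ x \subset A by apply: subD1set.
have b1 := IH _ lo (l x) (small _ sub1) lox.
have b2 := IH _ (r x) hi (small _ sub2) rhi.
suff [c1 c2] : \sum_(y in (A :\ x) :&: [set y | r y <= l x]) (r y - l y) <= l x - lo
  /\ \sum_(y in (A :\ x) :\: [set y | r y <= l x]) (r y - l y) <= hi - r x by lra.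
split; [apply: b1|apply: b2].
- move=> y; rewrite !inE => /andP[/andP[_ yA] ryx].
  by have [? ? _] := bnd _ yA.
- move=> y z /(subsetP sub1) /(subsetP AxA) yA /(subsetP sub1) /(subsetP AxA) zA.
  exact: dis.
- move=> y; rewrite !inE => /andP[ryx /andP[yx yA]].
  have [? ? ?] := bnd _ yA; split=> //.
  by have := dis _ _ yA xA yx; rewrite (negbTE ryx).
- move=> y z /(subsetP sub2) /(subsetP AxA) yA /(subsetP sub2) /(subsetP AxA) zA.
  exact: dis.
Qed.

End Intervals.

(** * The approximation ratio *)

Section Uniform.
Variables (R : realFieldType) (n : nat) (a b : R) (L : 'I_n -> R).
Local Notation I := (uniform_instance a b L).
Implicit Types (S : 'I_n -> R) (P : pred 'I_n) (i j : 'I_n) (c d : bool) (t u : R).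

(** * Conflicts between tasks and the search for an earliest start *)

Definition offset j c : R := if c then a + L j else 0.
Definition len c : R := if c then b else a.

(** In [(i, c, d)], task [c] belongs to the job [j] to be placed and task [d] to the blocking job
    [i]. *)
Definition hit S j t (x : 'I_n * bool * bool) : bool :=
  let: (i, c, d) := x in
  (t + offset j c < S i + offset i d + len d) &&
  (S i + offset i d < t + offset j c + len c).

(* The right end of the open interval of the [t] with [hit S j t x]. *)
Definition hit_end S j (x : 'I_n * bool * bool) : R :=
  let: (i, c, d) := x in S i + offset i d + len d - offset j c.

Lemma hit_end_gt S j t x : hit S j t x -> t < hit_end S j x.
Proof. by case: x => [[i c] d] /andP[h _]; rewrite ltrBrDr. Qed.

(** The hit times form an interval, so a later time that is not hit lies past its right end: a jump
    to [hit_end] skips no admissible start. *)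
Lemma hit_end_le S j t u x :
  hit S j t x -> ~~ hit S j u x -> t <= u -> hit_end S j x <= u.
Proof.
case: x => [[i c] d] /andP[h1 h2] + tu; rewrite negb_and -!leNgt /= => /orP[|]; lra.
Qed.

(** Potential of the search: it never exceeds [4 * n] and drops at each jump to a [hit_end]. *)
Definition pending S j t : nat := #|[pred x | t < hit_end S j x]|.

Lemma pending_le S j t : (pending S j t <= 4 * n)%N.
Proof.
apply: leq_trans (max_card _) _.
by rewrite !card_prod card_ord card_bool -mulnA mulnC.
Qed.

Lemma pending_hit S j t x :
  hit S j t x -> (pending S j (hit_end S j x) < pending S j t)%N.
Proof.
move=> /hit_end_gt tx; apply: proper_card; apply/properP; split.
  by apply/subsetP => y; rewrite !inE; apply: lt_trans.
by exists x; rewrite !inE ?ltxx.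
Qed.

Lemma task_uniform j c t :
  task I j c t = `]t + offset j c, t + offset j c + len c[.
Proof. by case: c; rewrite /task /offset /len /= ?addr0 ?addrA. Qed.

Hypotheses (a_gt0 : 0 < a) (b_gt0 : 0 < b).

Lemma len_gt0 c : 0 < len c.
Proof. by case: c. Qed.

Lemma task_disjointP S i j c d t :
  disjoint_itv (task I j c t) (task I i d (S i)) <-> ~~ hit S j t (i, c, d).
Proof. by rewrite !task_uniform; apply: disjoint_itvP; rewrite ltrDl len_gt0. Qed.

Lemma idle_forP P S j t :
  idle_for I P S j t <-> forall x, P x.1.1 -> ~~ hit S j t x.
Proof.
split=> [idl [[i c] d] /= Pi|nh i Pi c d]; first by apply/task_disjointP/idl.
exact/task_disjointP/nh.
Qed.

Lemma idle_for_dec P S j t : idle_for I P S j t \/ exists2 x, P x.1.1 & hit S j t x.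
Proof.
have [|no] := boolP [exists x, P x.1.1 && hit S j t x].
  by case/existsP => x /andP[Px hx]; right; exists x.
left; apply/idle_forP => x Px; apply: contra no => hx.
by apply/existsP; exists x; rewrite Px.
Qed.

(** A general ordered field need not have infima, so the minimum is reached by finitely many jumps
    from [0] along right ends of hits. *)
Lemma earliest_start_exists P S j : exists t, earliest_start I P S j t.
Proof.
(* The candidate [t] bounds all idle starts from below, so it is the minimum as soon as it is idle
   itself. *)
suff : forall t, 0 <= t -> (forall u, 0 <= u -> idle_for I P S j u -> t <= u) ->
    exists t, earliest_start I P S j t by move=> /(_ 0 (lexx 0)); apply.
move=> t; have [m] := ubnP (pending S j t); elim: m t => // m IH t tm t0 min.
have [idl|[x Px hx]] := idle_for_dec P S j t; first by exists t.
apply: (IH (hit_end S j x)).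
- exact: leq_trans (pending_hit hx) _.
- by apply: le_trans (ltW (hit_end_gt hx)).
- move=> u u0 idl; apply: hit_end_le hx _ (min _ u0 idl).
  by move/idle_forP: idl; apply.
Qed.

(** * Runs of the algorithm as growing lists of jobs *)

Lemma eq_earliest_start P Q S S' j t : P =1 Q -> (forall i, P i -> S i = S' i) ->
  earliest_start I P S j t -> earliest_start I Q S' j t.
Proof.
move=> PQ SS' [t0 idl min]; split=> //.
  by move=> i Qi c d; rewrite -SS' ?PQ //; apply: idl; rewrite ?PQ.
move=> u u0 idu; apply: min => // i Pi c d.
by rewrite SS' //; apply: idu; rewrite -PQ.
Qed.

(** A partial run: [w] lists the placed jobs in order of placement, and [S] matters on [w] only. The
    third clause keeps the list sorted when a further job is appended. *)
Definition greedy (w : seq 'I_n) S :=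
  [/\ uniq w, pairwise (fun i j => L i <= L j) w,
      {in w & [predC w], forall i j, L i <= L j}
    & {in w, forall j, earliest_start I (mem (take (index j w) w)) S j (S j)}].

Lemma greedy_rcons w S S' j :
  greedy w S -> j \notin w -> {in [predC w], forall i, L j <= L i} ->
  earliest_start I (mem w) S j (S' j) -> {in w, S =1 S'} ->
  greedy (rcons w j) S'.
Proof.
move=> [Uw sw wmin ew] jw jmin ej SS'; split.
- by rewrite rcons_uniq jw.
- rewrite pairwise_rcons sw andbT; apply/allP => i iw; exact: wmin.
- move=> i k; rewrite mem_rcons inE => /predU1P[->|iw] kw.
    by apply: jmin; move: kw; rewrite !inE mem_rcons inE negb_or => /andP[].
  by apply: wmin => //; move: kw; rewrite !inE mem_rcons inE negb_or => /andP[].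
- move=> i; rewrite mem_rcons inE -cats1 index_cat => /predU1P[->|iw].
    rewrite (negPf jw) /= eqxx addn0 take_size_cat //.
    by apply: eq_earliest_start ej.
  rewrite iw takel_cat ?index_size // -SS' //.
  by apply: eq_earliest_start (ew _ iw) => // k /mem_take; apply: SS'.
Qed.

Lemma greedy_next w : (size w < n)%N ->
  exists2 j, j \notin w & {in [predC w], forall i, L j <= L i}.
Proof.
move=> wn; have /existsP[j0 j0w] : [exists j, j \notin w].
  rewrite -negb_forall; apply/negP => /forallP all_w.
  move: wn; rewrite ltnNge -[n in (n <= _)%N]card_ord.
  by rewrite (leq_trans _ (card_size w)) // subset_leq_card //; apply/subsetP.
case: (Order.TotalTheory.arg_minP (P := [pred j | j \notin w]) L j0w) => j jw jmin.
by exists j.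
Qed.

Lemma greedy_exists k : (k <= n)%N -> exists w S, size w = k /\ greedy w S.
Proof.
elim: k => [_|k IH kn]; first by exists [::], (fun=> 0).
have [w [S [sw gw]]] := IH (ltnW kn).
have [|j jw jmin] := @greedy_next w; first by rewrite sw.
have [t et] := earliest_start_exists (mem w) S j.
exists (rcons w j), (fun i => if i == j then t else S i).
split; first by rewrite size_rcons sw.
apply: (greedy_rcons gw jw jmin); first by rewrite eqxx.
by move=> i iw; case: eqP iw => // ->; rewrite (negPf jw).
Qed.

Lemma greedy_algorithm1 w S : size w = n -> greedy w S -> algorithm1 I S.
Proof.
move=> sw [Uw w_sorted _ ew].
(* [k] is also the default of [nth], which is never returned since [size w = n]. *)
have inj_w : injective (fun k : 'I_n => nth k w k).
  move=> k l; rewrite (set_nth_default l) ?sw // => /eqP.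
  by rewrite nth_uniq ?sw // => /eqP/val_inj.
have [s sE] : exists s : {perm 'I_n}, forall k, s k = nth k w k.
  by exists (perm inj_w) => k; rewrite permE.
have index_w (k : 'I_n) : index (s k) w = k.
  by rewrite sE; apply: index_uniq; rewrite ?sw.
have s_in k : s k \in w by rewrite sE mem_nth ?sw.
exists s; split=> [k l kl|k].
  move: kl; rewrite leq_eqVlt => /predU1P[/val_inj-> //|kl].
  rewrite !sE (set_nth_default l) ?sw //.
  by apply: (pairwiseP l w_sorted) => //; rewrite inE sw.
apply: eq_earliest_start (ew _ (s_in k)) => // i.
rewrite index_w /= in_take_leq; last by rewrite sw ltnW.
have [l ->] : exists l, i = s l by exists (s^-1%g i); rewrite permKV.
by rewrite permK index_w.
Qed.

Lemma algorithm1_exists : exists S, algorithm1 I S.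
Proof.
by have [w [S [sw gw]]] := greedy_exists (leqnn n); exists S; exact: greedy_algorithm1 gw.
Qed.

(** * Feasibility and the two bounds on the objective *)

Hypothesis L_ge0 : forall j, 0 <= L j.

Lemma disjoint_itvC (A B : interval R) : disjoint_itv A B -> disjoint_itv B A.
Proof. by move=> AB x [Bx Ax]; apply: (AB x). Qed.

Lemma own_tasks_disjoint j c d t : c != d ->
  disjoint_itv (task I j c t) (task I j d t).
Proof.
(* The constant schedule makes [j], started at [t], its own opponent. *)
move=> cd; apply/(task_disjointP (fun=> t)).
have Lj := L_ge0 j.
rewrite /hit /offset /len; case: c d cd => [] [] // _; rewrite negb_and -!leNgt.
  by rewrite addr0; apply/orP; left; lra.
by rewrite addr0; apply/orP; right; lra.
Qed.

(** Of two distinct jobs, the one placed later was started where the machine was idle with respect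
    to the other. *)
Lemma algorithm1_feasible S : algorithm1 I S -> feasible I S.
Proof.
move=> [s [_ es]].
have early j : earliest_start I [pred i | (s^-1%g i < s^-1%g j)%N] S j (S j).
  by have := es (s^-1%g j); rewrite permKV.
split=> [j|i c j d]; first by have [] := early j.
have [->|ij _] := eqVneq i j.
  by move=> icd; apply: own_tasks_disjoint; apply: contra icd => /eqP->.
have [lt|lt|/val_inj/perm_inj E] := ltngtP (s^-1%g i) (s^-1%g j).
- by have [_ idl _] := early j; apply: disjoint_itvC; apply: idl.
- by have [_ idl _] := early i; apply: idl.
- by rewrite E eqxx in ij.
Qed.

Lemma blocked_start S (s : {perm 'I_n}) :
  (forall i j : 'I_n, (i <= j)%N -> L (s i) <= L (s j)) ->
  (forall k : 'I_n, earliest_start I [pred i | (s^-1%g i < k)%N] S (s k) (S (s k))) ->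
  forall (k : 'I_n) t, 0 <= t < S (s k) ->
    exists2 p : 'I_n, (p < k)%N &
      (S (s p) <= t < S (s p) + (a + b)) ||
      (S (s p) + L (s p) <= t < S (s p) + L (s p) + (a + b)).
Proof.
move=> srt es k; have [m] := ubnP k; elim: m k => // m IH k km t /andP[t0 tS].
have [_ _ min] := es k.
have [idl|[[[i c] d] /= ik hi]] := idle_for_dec [pred i | (s^-1%g i < k)%N] S (s k) t.
  by have := min t t0 idl; rewrite leNgt tS.
(* If [t] also precedes the start of the earlier job [i], induction on the position applies. *)
have [ti|it] := ltP t (S i).
  have [||p pi cov] := IH (s^-1%g i) _ t.
  - exact: leq_trans ik _.
  - by rewrite t0 permKV.
  - by exists p => //; apply: ltn_trans pi ik.
exists (s^-1%g i) => //; rewrite permKV.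
have Lik : L i <= L (s k) by have := srt _ _ (ltnW ik); rewrite permKV.
have Li0 := L_ge0 i.
have a0 := a_gt0; have b0 := b_gt0.
(* In order: second against second task, where [L i <= L (s k)] gives [t < S i + b]; second against
   first, impossible for [S i <= t]; first against second, giving the interval at [S i + L i]; first
   against first. *)
case/andP: hi; rewrite /offset /len; case: c d => [] []; rewrite ?addr0 => h1 h2.
- by apply/orP; left; apply/andP; split; lra.
- by exfalso; lra.
- by apply/orP; right; apply/andP; split; lra.
- by apply/orP; left; apply/andP; split; lra.
Qed.

(** Each of the [k] earlier jobs contributes two intervals of length [a + b], and by [blocked_start]
    they cover all times from [0] to the start. *)
Lemma start_bound S (s : {perm 'I_n}) :
  (forall i j : 'I_n, (i <= j)%N -> L (s i) <= L (s j)) ->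
  (forall k : 'I_n, earliest_start I [pred i | (s^-1%g i < k)%N] S (s k) (S (s k))) ->
  forall k : 'I_n, S (s k) <= (2 * k)%:R * (a + b).
Proof.
move=> srt es k.
pose ps := enum [pred p : 'I_n | (p < k)%N].
pose ls := [seq S (s p) | p <- ps] ++ [seq S (s p) + L (s p) | p <- ps].
have sz : (size ls <= 2 * k)%N.
  rewrite size_cat !size_map mul2n addnn leq_double.
  suff : (size (map val ps) <= size (iota 0 k))%N by rewrite size_map size_iota.
  apply: uniq_leq_size => [|_ /mapP[p pk ->]].
    by rewrite (map_inj_uniq val_inj) enum_uniq.
  by move: pk; rewrite mem_enum mem_iota.
suff : S (s k) - 0 <= (size ls)%:R * (a + b).
  rewrite subr0 => /le_trans; apply; rewrite ler_wpM2r ?ler_nat //.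
  by rewrite addr_ge0 ?ltW.
apply: covering_bound => [|t /(blocked_start srt es)[p pk /orP[] h]].
- by rewrite addr_ge0 ?ltW.
- exists (S (s p)) => //; rewrite mem_cat; apply/orP; left.
  by apply/mapP; exists p; rewrite // mem_enum.
- exists (S (s p) + L (s p)) => //; rewrite mem_cat; apply/orP; right.
  by apply/mapP; exists p; rewrite // mem_enum.
Qed.

Lemma sum_completion_le S : algorithm1 I S ->
  sum_completion I S <= \sum_j (a + b + L j) + (n * n.-1)%:R * (a + b).
Proof.
move=> [s [srt es]].
rewrite /sum_completion (reindex_inj (@perm_inj _ s)) /=.
rewrite [X in _ <= X + _](reindex_inj (@perm_inj _ s)) /=.
have -> : (n * n.-1 = \sum_(k < n) 2 * k)%N.
  by elim: (n) => [|m IH]; rewrite ?big_ord0 // big_ord_recr -IH /=; case: m {IH} => //= m; ring.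
rewrite natr_sum mulr_suml -big_split /=; apply: ler_sum => k _.
by have := start_bound srt es k; rewrite /completion /=; lra.
Qed.

(** The jobs that complete no later than [j] have all their tasks packed between [0] and the
    completion time of [j], and each brings length [a + b]. *)
Lemma completion_ge S j : feasible I S ->
  #|[set i | completion I S i <= completion I S j]|%:R * (a + b) <= completion I S j.
Proof.
move=> [S0 dis]; set A := [set i | _].
pose l (x : 'I_n * bool) : R := S x.1 + offset x.1 x.2.
pose r (x : 'I_n * bool) : R := l x + len x.2.
have C0 : 0 <= completion I S j.
  have := S0 j; have := L_ge0 j; have := a_gt0; have := b_gt0.
  by rewrite /completion /=; lra.
have -> : #|A|%:R * (a + b) = \sum_(x in setX A setT) (r x - l x).
  rewrite -sum1_card natr_sum mulr_suml.
  rewrite (eq_bigl (fun x => (x.1 \in A) && true)); last by move=> x; rewrite !inE.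
  rewrite -(pair_big (mem A) xpredT (fun i c => r (i, c) - l (i, c))) /=.
  by apply: eq_bigr => i _; rewrite big_bool /= /r /len /=; ring.
rewrite -[leRHS]subr0; apply: packing_bound => //.
- move=> [i c]; rewrite !inE andbT /r /l /completion /= /offset /len => iC.
  have := S0 i; have := L_ge0 i; have := a_gt0; have := b_gt0.
  by case: c; split; lra.
- move=> [i c] [k d] _ _ ne; have := dis _ _ _ _ ne.
  rewrite !task_uniform disjoint_itvP ?ltrDl ?len_gt0 //.
  by rewrite negb_and -!leNgt orbC.
Qed.

(** Instead of sorting by completion time, ordered pairs are counted. Two jobs are comparable in at
    least one direction and the diagonal always counts, so twice the number of pairs in [le] is at
    least [n * n + n]. *)
Lemma sum_completion_ge S : feasible I S ->
  (n * n.+1)%:R * (a + b) <= 2 * sum_completion I S.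
Proof.
move=> fS.
have ab : 0 <= a + b by rewrite addr_ge0 ?ltW.
pose le i j := (completion I S i <= completion I S j).
have : (n * n.+1 <= 2 * \sum_j #|[set i | le i j]|)%N.
  have -> : (\sum_j #|[set i | le i j]| = \sum_j \sum_i le i j)%N.
    apply: eq_bigr => j _; rewrite -sum1_card big_mkcond.
    by apply: eq_bigr => i _; rewrite inE; case: le.
  rewrite mul2n -addnn {2}exchange_big -big_split /=.
  have -> : (n * n.+1 = \sum_(j < n) \sum_(i < n) (1 + (i == j)))%N.
    rewrite (eq_bigr (fun=> n.+1)) ?sum_nat_const ?card_ord // => j _.
    rewrite big_split /= sum_nat_const card_ord muln1 -addn1 -big_mkcond /=.
    by rewrite big_pred1_eq.
  apply: leq_sum => j _; rewrite -big_split /=; apply: leq_sum => i _.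
  rewrite /le; have [->|_] := eqVneq i j; first by rewrite lexx.
  have := le_total (completion I S i) (completion I S j).
  by case: (_ <= _) => //=; case: (_ <= _).
rewrite -(ler_nat R) => /(ler_wpM2r ab) /le_trans; apply.
rewrite natrM natr_sum -mulrA mulr_suml ler_wpM2l // ler_sum // => j _.
exact: completion_ge.
Qed.

Lemma algorithm1_approx S S' : algorithm1 I S -> feasible I S' ->
  sum_completion I S <= 3 * sum_completion I S'.
Proof.
move=> /sum_completion_le leS fS'; have geS' := sum_completion_ge fS'.
have ab : 0 <= a + b by rewrite addr_ge0 ?ltW.
have : \sum_j (a + b + L j) <= sum_completion I S'.
  apply: ler_sum => j _; have [/(_ j)] := fS'.
  by rewrite /completion /=; lra.
have : (n * n.-1)%:R * (a + b) <= (n * n.+1)%:R * (a + b).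
  by rewrite ler_wpM2r // ler_nat leq_mul // (leq_trans (leq_pred _)).
lra.
Qed.

End Uniform.

Lemma eq_algorithm1 (R : realFieldType) n (I : instance R n) S S' :
  S =1 S' -> algorithm1 I S -> algorithm1 I S'.
Proof.
move=> SS' [s [srt es]]; exists s; split=> // k; rewrite -SS'.
have [t0 idl min] := es k; split=> // [i Pi c d|u u0 idu].
  by rewrite -SS'; apply: idl.
by apply: min => // i Pi c d; rewrite SS'; apply: idu.
Qed.

(** * Cost of a bounded number of machine steps *)

(** The computations of [run] with a unit charge per skip, assignment or test; this separates
    counting steps from bounding bit sizes. *)
Inductive steps : cmd -> state -> state -> nat -> Prop :=
| StepsSkip st : steps Skip st st 1
| StepsSetReg st r e :
    steps (SetReg r e) st (State (update (reg st) r (eval st e)) (memory st)) 1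
| StepsStore st e f :
    steps (Store e f) st
      (State (reg st) (update (memory st) (address (eval st e)) (eval st f))) 1
| StepsSeq c d st st' st'' t u :
    steps c st st' t -> steps d st' st'' u -> steps (Seq c d) st st'' (t + u)
| StepsIf b c d st st' t :
    steps (if eval_test st b then c else d) st st' t ->
    steps (If b c d) st st' t.+1
| StepsWhileFalse b c st : ~~ eval_test st b -> steps (While b c) st st 1
| StepsWhileTrue b c st st' st'' t u :
    eval_test st b -> steps c st st' t -> steps (While b c) st' st'' u ->
    steps (While b c) st st'' (t + u).+1.

(** Bounds both the number of nodes of [e] and the factor by which its value can exceed a bound, at
    least [1], on all registers and cells. *)
Fixpoint weight (e : expr) : nat :=
  match e with
  | Const z => (1 + `|z|)%N
  | Reg _ => 1
  | Fetch e => (1 + weight e)%N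
  | Add e f | Defs.Sub e f => (1 + weight e + weight f)%N
  end.

Definition test_weight (b : test) : nat :=
  match b with Le e f | Lt e f => (weight e + weight f)%N end.

Fixpoint cmd_weight (c : cmd) : nat :=
  match c with
  | Skip => 0
  | SetReg _ e => weight e
  | Store e f => (weight e + weight f)%N
  | Seq c d => (cmd_weight c + cmd_weight d)%N
  | If b c d => (test_weight b + cmd_weight c + cmd_weight d)%N
  | While b c => (test_weight b + cmd_weight c)%N
  end.

(** [D] is a common denominator, preserved by sums and differences, and [m] a logarithmic bound on
    the absolute value. *)
Definition small (D m : nat) (x : rat) : Prop :=
  x * D%:R \is a Num.int /\ `|x| <= (2 ^ m)%:R.

Definition small_state D m (st : state) : Prop :=
  (forall r, small D m (reg st r)) /\ (forall k, small D m (memory st k)).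

Lemma small_weaken D m m' x : (m <= m')%N -> small D m x -> small D m' x.
Proof.
move=> mm' [xD xm]; split=> //; apply: le_trans xm _.
by rewrite ler_nat leq_exp2l.
Qed.

Lemma small_state_weaken D m m' st :
  (m <= m')%N -> small_state D m st -> small_state D m' st.
Proof. by move=> mm' [sr sm]; split=> k; apply: small_weaken mm' _. Qed.

Lemma small_state_reg D m st r x :
  small_state D m st -> small D m x ->
  small_state D m (State (update (reg st) r x) (memory st)).
Proof. by move=> [sr sm] sx; split=> k //=; rewrite /update; case: eqP. Qed.

Lemma small_state_mem D m st r x :
  small_state D m st -> small D m x ->
  small_state D m (State (reg st) (update (memory st) r x)).
Proof. by move=> [sr sm] sx; split=> k //=; rewrite /update; case: eqP. Qed.

Lemma small_eval_weight D m st e : small_state D m st ->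
  eval st e * D%:R \is a Num.int /\ `|eval st e| <= (weight e * 2 ^ m)%:R.
Proof.
move=> [sr sm]; elim: e => [z|r|e _|e [IHe1 IHe2] f [IHf1 IHf2]|e [IHe1 IHe2] f [IHf1 IHf2]] /=.
- split; first by rewrite rpredM // ?rpred_int ?rpred_nat.
  rewrite -intr_norm -natr_absz ler_nat.
  by rewrite (leq_trans _ (leq_pmulr _ _)) ?expn_gt0 // leq_addl.
- by rewrite mul1n; apply: sr.
- have [sD sB] := sm (address (eval st e)); split=> //; apply: le_trans sB _.
  by rewrite ler_nat leq_pmull.
- split; first by rewrite mulrDl rpredD.
  apply: le_trans (ler_normD _ _) _; apply: le_trans (lerD IHe2 IHf2) _.
  by rewrite -natrD ler_nat -mulnDl leq_mul2r leq_add2r leq_addl orbT.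
- split; first by rewrite mulrBl rpredB.
  apply: le_trans (ler_normB _ _) _; apply: le_trans (lerD IHe2 IHf2) _.
  by rewrite -natrD ler_nat -mulnDl leq_mul2r leq_add2r leq_addl orbT.
Qed.

Lemma small_eval D m W st e : small_state D m st -> (weight e <= W)%N ->
  small D (m + W) (eval st e).
Proof.
move=> ss eW; have [eD eB] := small_eval_weight e ss; split=> //.
(* The factor [weight e] adds at most [W] to the exponent, because [weight e <= 2 ^ W]. *)
apply: le_trans eB _; rewrite ler_nat addnC expnD leq_mul2r; apply/orP; right.
exact: leq_trans eW (ltnW (ltn_expl _ _)).
Qed.

Lemma bitlen_le m k : (m < 2 ^ k.+1)%N -> (bitlen m <= k.+1)%N.
Proof.
rewrite /bitlen ltnS; case: m => [|m] mk; first by rewrite trunc_log0.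
by rewrite -ltnS -(ltn_exp2l _ _ (ltnSn 1)) (leq_ltn_trans _ mk) ?trunc_logP.
Qed.

Lemma bitlen_gt m : (m < 2 ^ bitlen m)%N.
Proof. exact: trunc_log_ltn. Qed.

(** If [x * D = z], then [numq x * D = z * denq x], and [numq x] is coprime to [denq x]. *)
Lemma denq_dvd (D : nat) (x : rat) :
  x * D%:R \is a Num.int -> (`|denq x| %| D)%N.
Proof.
move=> /intrP[z xD].
have : ((numq x * D)%:~R : rat) = (z * denq x)%:~R.
  by rewrite !intrM numqE -xD; ring.
move=> /intr_inj/(congr1 absz); rewrite !abszM => E.
have : (`|denq x| %| `|numq x| * D)%N by rewrite E dvdn_mull.
by rewrite Gauss_dvdr // coprime_sym coprime_num_den.
Qed.

(** The denominator divides [D], hence is at most [2 ^ s]. The numerator is [x] times the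
    denominator, hence at most [2 ^ (m + s)] in absolute value. Each bit length adds one. *)
Lemma rat_size_small D s m x : (0 < D)%N -> (D <= 2 ^ s)%N -> small D m x ->
  (rat_size x <= m + 2 * s + 2)%N.
Proof.
move=> D0 Ds [xD xm].
have den : (`|denq x| <= 2 ^ s)%N by apply: leq_trans Ds; rewrite dvdn_leq ?denq_dvd.
have num : (`|numq x| <= 2 ^ (m + s))%N.
  rewrite -(ler_nat rat) natr_absz intr_norm numqE normrM expnD natrM.
  by rewrite ler_pM // -intr_norm -natr_absz ler_nat.
have := @bitlen_le `|numq x| (m + s); have := @bitlen_le `|denq x| s.
rewrite !expnS; have := expn_gt0 2 s; have := expn_gt0 2 (m + s).
rewrite /rat_size; lia.
Qed.

Lemma eval_cost_small D m W s st e : (0 < D)%N -> (D <= 2 ^ s)%N ->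
  small_state D m st -> (weight e <= W)%N ->
  (eval_cost st e <= weight e * (m + W + 2 * s + 3))%N.
Proof.
move=> D0 Ds ss.
have sz f : (weight f <= W)%N -> (rat_size (eval st f) <= m + W + 2 * s + 2)%N.
  by move=> fW; apply: (rat_size_small D0 Ds); apply: small_eval ss fW.
elim: e => [z|r|e IH|e IHe f IHf|e IHe f IHf] W' /=.
- by have := sz _ W'; rewrite /=; set q := rat_size _; nia.
- by have := sz _ W'; rewrite /=; set q := rat_size _; lia.
- have := sz _ W'; rewrite /= in W' *; have := IH (ltnW W').
  by set q := rat_size _; lia.
- have := sz _ W'; rewrite /= in W' *; have := IHe _; have := IHf _.
  by set q := rat_size _; lia.
- have := sz _ W'; rewrite /= in W' *; have := IHe _; have := IHf _.
  by set q := rat_size _; lia.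
Qed.

Lemma test_cost_small D m W s st b : (0 < D)%N -> (D <= 2 ^ s)%N ->
  small_state D m st -> (test_weight b <= W)%N ->
  (test_cost st b <= 1 + W * (m + W + 2 * s + 3))%N.
Proof.
move=> D0 Ds ss; case: b => e f /= bW.
  all: have [eW fW] : (weight e <= W)%N /\ (weight f <= W)%N by lia.
  all: have := eval_cost_small D0 Ds ss eW; have := eval_cost_small D0 Ds ss fW; nia.
Qed.

(* An addition can at most double the largest absolute value and creates no new prime in a
   denominator, so bit sizes grow linearly with the number of steps. *)
Lemma run_steps D W s c st st' u m M :
  (0 < D)%N -> (D <= 2 ^ s)%N -> steps c st st' u -> (cmd_weight c <= W)%N ->
  small_state D m st -> (m + u * W <= M)%N ->
  small_state D (m + u * W) st' /\
  exists2 t, run c st st' t & (t <= u * (1 + W * (M + W + 2 * s + 3)))%N.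
Proof.
(* [m] grows along the run, while [M] caps the final exponent, so that all steps are charged the
   same amount. *)
move=> D0 Ds run_c; elim: run_c m => {c st st' u}.
- move=> st m _ ss _; split; first by apply: small_state_weaken ss; lia.
  by exists 1%N; [constructor | lia].
- move=> st r e m /= eW ss mM; split.
    rewrite mul1n; apply: small_state_reg (small_eval ss eW).
    by apply: small_state_weaken ss; lia.
  exists (1 + eval_cost st e)%N; first by constructor.
  by have := eval_cost_small D0 Ds ss eW; nia.
- move=> st e f m /= efW ss mM.
  have [eW fW] : (weight e <= W)%N /\ (weight f <= W)%N by lia.
  split.
    rewrite mul1n; apply: small_state_mem (small_eval ss fW).
    by apply: small_state_weaken ss; lia.
  exists (1 + eval_cost st e + eval_cost st f)%N; first by constructor.
  have := eval_cost_small D0 Ds ss eW; have := eval_cost_small D0 Ds ss fW; nia.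
- move=> c d st st' st'' t u _ IHc _ IHd m /= cdW ss mM.
  have [||ss' [t' rc ct']] := IHc m _ ss; [lia|nia|].
  have [||ss'' [u' rd cu']] := IHd _ _ ss'; [lia|nia|].
  split; first by rewrite mulnDl addnA.
  by exists (t' + u')%N; [apply: RunSeq rd | rewrite mulnDl leq_add].
- move=> b c d st st' t _ IH m /= bW ss mM.
  have [||ss' [t' rc ct']] := IH m _ ss; [by case: ifP; lia|nia|].
  split; first by apply: small_state_weaken ss'; nia.
  exists (test_cost st b + t')%N; first exact: RunIf.
  have bW' : (test_weight b <= W)%N by lia.
  have := test_cost_small D0 Ds ss bW'; nia.
- move=> b c st nb m /= bW ss mM.
  have bW' : (test_weight b <= W)%N by lia.
  split; first by apply: small_state_weaken ss; lia.
  exists (test_cost st b); first exact: RunWhileFalse.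
  have := test_cost_small D0 Ds ss bW'; nia.
- move=> b c st st' st'' t u tb _ IHc _ IHw m /= bW ss mM.
  have bW' : (test_weight b <= W)%N by lia.
  have [||ss' [t' rc ct']] := IHc m _ ss; [lia|nia|].
  have [||ss'' [u' rw cu']] := IHw _ _ ss'; [done|nia|].
  split; first by apply: small_state_weaken ss''; nia.
  exists (test_cost st b + t' + u')%N; first exact: RunWhileTrue rc rw.
  have := test_cost_small D0 Ds ss bW'; nia.
Qed.

(** * Bit sizes of the input *)

Section Input.
Variables (n : nat) (a b : rat) (L : 'I_n -> rat).

Lemma size_encode : size (encode a b L) = (n + 3)%N.
Proof. by rewrite /= size_map size_enum_ord addnC. Qed.

Lemma input_size_ge : (n <= input_size a b L)%N.
Proof.
apply: leq_trans (_ : size (encode a b L) <= _)%N; first by rewrite size_encode leq_addr.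
rewrite /input_size -sum1_size; apply: leq_sum => x _.
by rewrite /rat_size /bitlen addSn.
Qed.

(** [D] is the product of all input denominators. Each is below [2] to its bit length, and these
    lengths add up to at most the input size. *)
Lemma initial_state_small : exists2 D, (0 < D)%N & (D <= 2 ^ input_size a b L)%N /\
  small_state D (input_size a b L) (initial_state a b L).
Proof.
pose D := (\prod_(x <- encode a b L) `|denq x|)%N.
have sizeE x : x \in encode a b L -> (rat_size x <= input_size a b L)%N.
  by move=> xin; rewrite /input_size (big_rem x) //= leq_addr.
exists D; first by rewrite prodn_gt0 // => x; rewrite absz_gt0 denq_neq0.
split.
  rewrite /D /input_size; elim: (encode a b L) => [|x s IH]; first by rewrite !big_nil.
  rewrite !big_cons expnD leq_mul //; apply: leq_trans (ltnW (bitlen_gt _)) _.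
  by rewrite leq_exp2l // leq_addl.
have small0 : small D (input_size a b L) 0.
  by split; rewrite ?mul0r ?rpred0 // normr0 ler0n.
split=> [//|k /=]; have [kn|kn] := ltnP k (size (encode a b L)); last by rewrite nth_default.
have := mem_nth 0 kn; move: (nth 0 _ k) => x xin; split.
  rewrite /D (big_rem x) //= natrM mulrA rpredM ?rpred_nat //.
  by rewrite natr_absz normr_denq -numqE rpred_int.
apply: (@le_trans _ _ `|numq x|%N%:R).
  rewrite natr_absz intr_norm numqE normrM ler_peMr //.
  by rewrite -intr_norm -natr_absz ler1n absz_gt0 denq_neq0.
rewrite ler_nat; apply: leq_trans (ltnW (bitlen_gt _)) _.
by rewrite leq_exp2l // (leq_trans _ (sizeE _ xin)) // leq_addr.
Qed.

End Input.

(** * The program *)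

(** A total-correctness triple with step budget [U]. Postconditions nest, so a program is verified
    from front to back. *)
Definition ends c st (U : nat) (Q : state -> Prop) : Prop :=
  exists st' u, [/\ steps c st st' u, (u <= U)%N & Q st'].

Lemma ends_weaken c st U V (Q Q' : state -> Prop) :
  ends c st U Q -> (U <= V)%N -> (forall st', Q st' -> Q' st') -> ends c st V Q'.
Proof.
move=> [st' [u [run_c uU Qst']]] UV QQ'; exists st', u.
by split; [|exact: leq_trans UV|exact: QQ'].
Qed.

Lemma ends_skip st U (Q : state -> Prop) : Q st -> ends Skip st U.+1 Q.
Proof. by move=> Qst; exists st, 1%N; split=> //; constructor. Qed.

Lemma ends_setreg st r e U (Q : state -> Prop) :
  Q (State (update (reg st) r (eval st e)) (memory st)) -> ends (SetReg r e) st U.+1 Q.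
Proof. by move=> Qst; eexists _, 1%N; split; [constructor| |]. Qed.

Lemma ends_store st e f U (Q : state -> Prop) :
  Q (State (reg st) (update (memory st) (address (eval st e)) (eval st f))) ->
  ends (Store e f) st U.+1 Q.
Proof. by move=> Qst; eexists _, 1%N; split; [constructor| |]. Qed.

Lemma ends_seq c d st U V Q :
  ends c st U (fun st' => ends d st' V Q) -> ends (Seq c d) st (U + V) Q.
Proof.
move=> [st' [u [run_c uU [st'' [v [run_d vV Qst'']]]]]].
by exists st'', (u + v)%N; split; [exact: StepsSeq run_d|exact: leq_add|].
Qed.

Lemma ends_if b c d st U Q :
  ends (if eval_test st b then c else d) st U Q -> ends (If b c d) st U.+1 Q.
Proof.
move=> [st' [u [run_c uU Qst']]].
by exists st', u.+1; split=> //; exact: StepsIf.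
Qed.

(** [m] is a variant that every iteration lowers. An iteration costs at most [U] steps and one test;
    the final failing test adds one. *)
Lemma ends_while b c U (Inv : nat -> state -> Prop) m st :
  (forall m st, Inv m st -> eval_test st b ->
     ends c st U (fun st' => exists2 m', (m' < m)%N & Inv m' st')) ->
  Inv m st ->
  ends (While b c) st (m * U.+1).+1 (fun st' => ~~ eval_test st' b /\ exists m', Inv m' st').
Proof.
move=> step; have [k] := ubnP m; elim: k m st => // k IH m st mk inv.
have [tb|ntb] := boolP (eval_test st b); last first.
  by exists st, 1%N; split=> //; [exact: StepsWhileFalse|split=> //; exists m].
have [st' [u [run_c uU [m' m'm inv']]]] := step _ _ inv tb.
have [|st'' [v [run_w vV Q]]] := IH m' st' _ inv'; first exact: leq_trans m'm _.
exists st'', (u + v).+1; split=> //; first exact: StepsWhileTrue run_w.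
by move: vV uU m'm; nia.
Qed.

Lemma eval_testLt st e f : eval_test st (Lt e f) = (eval st e < eval st f).
Proof. by []. Qed.

Lemma eval_testLe st e f : eval_test st (Le e f) = (eval st e <= eval st f).
Proof. by []. Qed.

Lemma address_nat k : address k%:R = k.
Proof. by rewrite /address pmulrn numq_int. Qed.

(** The first three registers hold [n], [a] and [b]; [rK] counts the scheduled jobs, [rJ] is the job
    being handled, [rI] the loop index and [rT] the candidate start. *)
Local Notation rN := (Reg 0).
Local Notation rA := (Reg 1).
Local Notation rB := (Reg 2).
Local Notation rK := (Reg 3).
Local Notation rJ := (Reg 4).
Local Notation rI := (Reg 5).
Local Notation rT := (Reg 6).

(* The memory holds the delays from cell [3] on, then the starting times of the scheduled jobs,
   then a flag for each job that tells whether it is scheduled. *)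
Definition delay_cell (e : expr) := Add (Const (Posz 3)) e.
Definition start_cell (e : expr) := Add (Add (Const (Posz 3)) rN) e.
Definition flag_cell (e : expr) := Add (Add (Add (Const (Posz 3)) rN) rN) e.

Definition next_job := SetReg 5 (Add rI (Const (Posz 1))).

Definition select_loop :=
  While (Lt rI rN)
    (Seq (If (Le (Fetch (flag_cell rI)) (Const (Posz 0)))
            (If (Lt rJ (Const (Posz 0))) (SetReg 4 rI)
               (If (Lt (Fetch (delay_cell rI)) (Fetch (delay_cell rJ)))
                  (SetReg 4 rI) Skip))
            Skip)
         next_job).

(** [Negz 0] is [-1]: a negative [rJ] means that no unscheduled job has been met yet. *)
Definition select :=
  Seq (SetReg 4 (Const (Negz 0))) (Seq (SetReg 5 (Const (Posz 0))) select_loop).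

Definition offset_expr (e : expr) (c : bool) :=
  if c then Add rA (Fetch (delay_cell e)) else Const (Posz 0).
Definition len_expr (c : bool) := if c then rB else rA.

Definition task_start (d : bool) := Add (Fetch (start_cell rI)) (offset_expr rI d).
Definition task_end (d : bool) := Add (task_start d) (len_expr d).

(** On a conflict the candidate jumps to the right end, and the scan restarts at job [0], since a
    job already passed may block the new candidate. *)
Definition check (c d : bool) (next : cmd) :=
  let s := Add rT (offset_expr rJ c) in
  If (Lt s (task_end d))
    (If (Lt (task_start d) (Add s (len_expr c)))
       (Seq (SetReg 6 (Defs.Sub (task_end d) (offset_expr rJ c)))
            (SetReg 5 (Const (Posz 0))))
       next)
    next.

Definition place_loop :=
  While (Lt rI rN)
    (If (Lt (Const (Posz 0)) (Fetch (flag_cell rI)))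
       (check false false (check false true (check true false (check true true next_job))))
       next_job).

Definition place :=
  Seq (SetReg 6 (Const (Posz 0))) (Seq (SetReg 5 (Const (Posz 0))) place_loop).

Definition record :=
  Seq (Store (start_cell rJ) rT)
    (Seq (Store (flag_cell rJ) (Const (Posz 1))) (SetReg 3 (Add rK (Const (Posz 1))))).

Definition main_loop := While (Lt rK rN) (Seq select (Seq place record)).

Definition init :=
  Seq (SetReg 0 (Fetch (Const (Posz 0))))
    (Seq (SetReg 1 (Fetch (Const (Posz 1)))) (SetReg 2 (Fetch (Const (Posz 2))))).

(** The target cells lie below [n] and the start cells from [3 + n] on, so no starting time is
    overwritten before it is read. *)
Definition copy_loop :=
  While (Lt rI rN) (Seq (Store rI (Fetch (start_cell rI))) next_job).

Definition scheduler :=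
  Seq init (Seq main_loop (Seq (SetReg 5 (Const (Posz 0))) copy_loop)).

(** * Correctness and step count of the program *)

Section Correctness.
Variables (n : nat) (a b : rat) (L : 'I_n -> rat).
Local Notation I := (uniform_instance a b L).
(** A well-formed instance without jobs says nothing about [a] and [b], hence the guards. *)
Hypotheses (a_gt0 : (0 < n)%N -> 0 < a) (b_gt0 : (0 < n)%N -> 0 < b).
Implicit Types (S : 'I_n -> rat) (w : seq 'I_n) (i j : 'I_n) (st : state).

Record layout S w st : Prop := Layout {
  layout_n : reg st 0 = n%:R;
  layout_a : reg st 1 = a;
  layout_b : reg st 2 = b;
  layout_k : reg st 3 = (size w)%:R;
  layout_delay : forall i, memory st (3 + i) = L i;
  layout_start : forall i, memory st (3 + n + i) = S i;
  layout_flag : forall i, memory st (3 + n + n + i) = (i \in w)%:R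
}.

Lemma layout_setreg S w st r x : (3 < r)%N -> layout S w st ->
  layout S w (State (update (reg st) r x) (memory st)).
Proof.
move=> r3 [l0 l1 l2 l3 lL lS lF].
by split=> //=; rewrite /update; case: eqP r3 => // <-.
Qed.

Lemma eval_delay S w st r i : layout S w st -> reg st r = i%:R ->
  eval st (Fetch (delay_cell (Reg r))) = L i.
Proof.
by move=> lay ri /=; rewrite ri -pmulrn -natrD address_nat (layout_delay lay).
Qed.

Lemma eval_start_cell S w st r i : layout S w st -> reg st r = i%:R ->
  eval st (start_cell (Reg r)) = (3 + n + i)%:R.
Proof. by move=> lay ri /=; rewrite ri (layout_n lay) -pmulrn -!natrD. Qed.

Lemma eval_flag_cell S w st r i : layout S w st -> reg st r = i%:R ->
  eval st (flag_cell (Reg r)) = (3 + n + n + i)%:R.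
Proof. by move=> lay ri /=; rewrite ri (layout_n lay) -pmulrn -!natrD. Qed.

Lemma eval_start S w st r i : layout S w st -> reg st r = i%:R ->
  eval st (Fetch (start_cell (Reg r))) = S i.
Proof.
move=> lay ri; rewrite -[LHS]/(memory st (address (eval st (start_cell (Reg r))))).
by rewrite (eval_start_cell lay ri) address_nat (layout_start lay).
Qed.

Lemma eval_flag S w st r i : layout S w st -> reg st r = i%:R ->
  eval st (Fetch (flag_cell (Reg r))) = (i \in w)%:R.
Proof.
move=> lay ri; rewrite -[LHS]/(memory st (address (eval st (flag_cell (Reg r))))).
by rewrite (eval_flag_cell lay ri) address_nat (layout_flag lay).
Qed.

Lemma loop_test S w st (i : nat) : layout S w st -> reg st 5 = i%:R ->
  eval_test st (Lt rI rN) = (i < n)%N.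
Proof. by move=> lay ri /=; rewrite ri (layout_n lay) ltr_nat. Qed.

Lemma ends_next_job S w st (i U : nat) (Q : state -> Prop) :
  layout S w st -> reg st 5 = i%:R ->
  (forall st', layout S w st' -> reg st' 5 = i.+1%:R ->
    (forall r, r != 5 -> reg st' r = reg st r) -> Q st') ->
  ends next_job st U.+1 Q.
Proof.
move=> lay ri HQ; apply: ends_setreg; apply: HQ; first exact: layout_setreg.
  by rewrite /= /update /= ri -pmulrn natr1.
by move=> r r5 /=; rewrite /update (negPf r5).
Qed.

Lemma ends_select S w st : greedy a b L w S -> (size w < n)%N -> layout S w st ->
  ends select st (2 + (n * 6).+1) (fun st' => layout S w st' /\
    exists2 j : 'I_n, reg st' 4 = j%:R & j \notin w /\ {in [predC w], forall i, L j <= L i}).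
Proof.
move=> gw wn lay; apply: (@ends_seq _ _ _ 1 (n * 6).+2); apply: ends_setreg.
apply: (@ends_seq _ _ _ 1 (n * 6).+1); apply: ends_setreg.
set st0 := State _ _.
have lay0 : layout S w st0 by do 2 apply: layout_setreg => //.
pose best (i : nat) st' := reg st' 5 = i%:R /\ layout S w st' /\
  ((reg st' 4 = -1 /\ forall k : 'I_n, (k < i)%N -> k \in w) \/
   exists2 j : 'I_n, reg st' 4 = j%:R & j \notin w /\
     forall k : 'I_n, (k < i)%N -> k \notin w -> L j <= L k).
pose Inv m st' := exists2 i : nat, (i + m = n)%N & best i st'.
have inv0 : Inv n st0 by exists 0%N => //; split=> //; split=> //; left; split.
apply: (ends_weaken (ends_while (U := 5) _ inv0)); last 2 first.
- by rewrite leqnn.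
- move=> st' [+ [m [i im [ri [lay' sel]]]]].
  rewrite (loop_test lay' ri) -leqNgt => ni; split=> //.
  have lt_i (k : 'I_n) : (k < i)%N by apply: leq_trans ni.
  case: sel => [[_ allw]|[j rj [jw jmin]]].
    (* The value [-1] cannot survive the scan, since [size w < n] leaves some job unscheduled. *)
    by have [j] := greedy_next L wn; rewrite allw.
  by exists j => //; split=> // k kw; apply: jmin.
move=> {lay st0 lay0 inv0} m st' [i im [ri [lay sel]]].
rewrite (loop_test lay ri) => iN.
pose k := Ordinal iN.
have rk : reg st' 5 = k%:R by [].
have lt_iS (l : 'I_n) : (l < i.+1)%N -> l = k \/ (l < i)%N.
  by rewrite ltnS leq_eqVlt => /orP[/eqP li|]; [left; apply: val_inj|right].
pose best' st1 := reg st1 5 = i%:R /\ layout S w st1 /\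
  ((reg st1 4 = -1 /\ forall k : 'I_n, (k < i.+1)%N -> k \in w) \/
   exists2 j : 'I_n, reg st1 4 = j%:R & j \notin w /\
     forall k : 'I_n, (k < i.+1)%N -> k \notin w -> L j <= L k).
have next st1 : best' st1 -> ends next_job st1 1 (fun st2 => exists2 m', (m' < m)%N & Inv m' st2).
  move=> [ri1 [lay1 sel1]]; apply: (ends_next_job 0 lay1 ri1) => st2 lay2 ri2 same.
  exists m.-1; first lia.
  exists i.+1; first lia.
  by split=> //; split=> //; rewrite same.
apply: (@ends_seq _ _ _ 4 1); apply: (ends_weaken _ (leqnn _) next).
apply: ends_if; rewrite eval_testLe (eval_flag lay rk) /=.
have [kw|kw] := boolP (k \in w).
  apply: ends_skip; split=> //; split=> //.
  case: sel => [[rj allw]|[j rj [jw jmin]]]; [left|right].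
    by split=> // l /lt_iS[->|] //; apply: allw.
  exists j => //; split=> // l /lt_iS[->|]; last exact: jmin.
  by rewrite kw.
have best_k : (forall l : 'I_n, (l < i)%N -> l \notin w -> L k <= L l) ->
    best' (State (update (reg st') 4 (eval st' rI)) (memory st')).
  move=> kmin; split=> //; split; first exact: layout_setreg.
  right; exists k => //; split=> // l /lt_iS[->|]; last exact: kmin.
  by rewrite lexx.
apply: ends_if; rewrite eval_testLt [eval _ rJ]/=.
case: sel => [[-> allw]|[j rj [jw jmin]]].
  apply: ends_setreg; apply: best_k => l /allw lw.
  by rewrite lw.
rewrite rj -[eval _ _]/0 ltrn0; apply: ends_if.
rewrite eval_testLt (eval_delay lay rk) (eval_delay lay rj).
case: ltP => [kj|jk].
  apply: ends_setreg; apply: best_k => l li lw.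
  by apply: le_trans (ltW kj) (jmin l li lw).
apply: ends_skip; split=> //; split=> //; right; exists j => //; split=> // l.
by move=> /lt_iS[->|] //; apply: jmin.
Qed.

Lemma eval_offset S w st r i c : layout S w st -> reg st r = i%:R ->
  eval st (offset_expr (Reg r) c) = offset a L i c.
Proof.
move=> lay ri; case: c => //.
rewrite -[LHS]/(reg st 1 + eval st (Fetch (delay_cell (Reg r)))).
by rewrite (eval_delay lay ri) (layout_a lay).
Qed.

Lemma eval_len S w st c : layout S w st -> eval st (len_expr c) = len a b c.
Proof. by case: c => -[]. Qed.

(** A hit costs two tests and two assignments, a miss at most two tests before [next]; both fit into
    [U + 4]. *)
Lemma ends_check S w st i j c d next U (Q : state -> Prop) :
  layout S w st -> reg st 5 = i%:R -> reg st 4 = j%:R ->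
  (hit a b L S j (reg st 6) (i, c, d) ->
     Q (State (update (update (reg st) 6 (hit_end a b L S j (i, c, d))) 5 0) (memory st))) ->
  (~~ hit a b L S j (reg st 6) (i, c, d) -> ends next st U Q) ->
  ends (check c d next) st (U + 4) Q.
Proof.
move=> lay ri rj Qhit Qmiss.
have startE : eval st (task_start d) = S i + offset a L i d.
  by rewrite -(eval_start lay ri) -(eval_offset d lay ri).
have endE : eval st (task_end d) = S i + offset a L i d + len a b d.
  by rewrite -startE -(eval_len d lay).
have sE : eval st (Add rT (offset_expr rJ c)) = reg st 6 + offset a L j c.
  by rewrite -(eval_offset c lay rj).
have sE' : eval st (Add (Add rT (offset_expr rJ c)) (len_expr c)) =
    reg st 6 + offset a L j c + len a b c.
  by rewrite -sE -(eval_len c lay).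
rewrite addnC; apply: ends_if; rewrite eval_testLt sE endE.
move: Qhit Qmiss; rewrite /hit; case: ltP => /= _ Qhit Qmiss; last first.
  by apply: ends_weaken (Qmiss isT) _ _; first lia.
apply: ends_if; rewrite eval_testLt startE sE'.
case: ltP Qhit Qmiss => /= _ Qhit Qmiss; last first.
  by apply: ends_weaken (Qmiss isT) _ _; first lia.
rewrite -[(U.+2)%N]/(1 + U.+1)%N.
apply: ends_seq; apply: ends_setreg; apply: ends_setreg.
suff -> : eval st (Defs.Sub (task_end d) (offset_expr rJ c)) =
    S i + offset a L i d + len a b d - offset a L j c by apply: Qhit.
by rewrite -endE -(eval_offset c lay rj).
Qed.

(** An iteration costs at most [19]: the loop test, the flag test, four checks of cost [4] and an
    increment. Initialisation and the last test add [3]. *)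
Definition place_cost := ((4 * n * n.+1 + n) * 19 + 3)%N.

Lemma ends_place S w st j : layout S w st -> reg st 4 = j%:R ->
  ends place st place_cost (fun st' => [/\ layout S w st', reg st' 4 = j%:R
    & earliest_start I (mem w) S j (reg st' 6)]).
Proof.
move=> lay rj.
have n0 : (0 < n)%N by apply: leq_ltn_trans (ltn_ord j).
have a0 := a_gt0 n0; have b0 := b_gt0 n0.
rewrite /place_cost addnC.
apply: (@ends_seq _ _ _ 1 ((4 * n * n.+1 + n) * 19).+2); apply: ends_setreg.
apply: (@ends_seq _ _ _ 1 ((4 * n * n.+1 + n) * 19).+1); apply: ends_setreg.
set st0 := State _ _.
have lay0 : layout S w st0 by do 2 apply: layout_setreg => //.
(* Every candidate bounds the idle starts from below, so the first to survive a full scan is the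
   earliest. *)
pose lower t := 0 <= t /\ forall u, 0 <= u -> idle_for I (mem w) S j u -> t <= u.
(* The variant is lexicographic: a jump lowers [pending] and resets [i], otherwise [i] grows. The
   factor [n.+1] exceeds every value of [n - i]. *)
pose Inv m st' := exists i : nat, [/\ (i <= n)%N,
    (m = pending a b L S j (reg st' 6) * n.+1 + (n - i))%N,
    reg st' 5 = i%:R /\ reg st' 4 = j%:R, layout S w st' &
    lower (reg st' 6) /\ forall x, x.1.1 \in w -> (x.1.1 < i)%N ->
      ~~ hit a b L S j (reg st' 6) x].
have inv0 : Inv (pending a b L S j 0 * n.+1 + n)%N st0.
  by exists 0%N; split=> //; first rewrite subn0.
apply: (ends_weaken (ends_while (U := 18) _ inv0)); last 2 first.
- by rewrite ltnS leq_mul2r /= leq_add2r leq_mul2r pending_le orbT.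
- move=> st' [+ [m [i [_ im [ri rj'] lay' [[t0 low] nh]]]]].
  rewrite (loop_test lay' ri) -leqNgt => ni; split=> //; split=> //.
  apply/idle_forP => // x xw; apply: nh => //.
  exact: leq_trans (ltn_ord _) ni.
move=> {lay rj st0 lay0 inv0} m st' [i [_ mE [ri rj] lay [[t0 low] nh]]].
rewrite (loop_test lay ri) => iN.
pose k := Ordinal iN.
have rk : reg st' 5 = k%:R by [].
pose Q st1 := exists2 m', (m' < m)%N & Inv m' st1.
have miss : (k \in w -> forall x, x.1.1 = k -> ~~ hit a b L S j (reg st' 6) x) ->
    ends next_job st' 1 Q.
  move=> nk; apply: (ends_next_job 0 lay ri) => st1 lay1 ri1 same.
  exists (pending a b L S j (reg st' 6) * n.+1 + (n - i.+1))%N.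
    by rewrite mE ltn_add2l ltn_sub2l.
  exists i.+1; rewrite (same 4%N isT) (same 6%N isT); split=> //.
  split=> // x xw; rewrite ltnS leq_eqVlt => /orP[/eqP xi|]; last exact: nh.
  have xk : x.1.1 = k by apply: val_inj.
  by apply: nk; rewrite -?xk.
apply: ends_if; rewrite eval_testLt (eval_flag lay rk) -[eval _ _]/0 ltr0n lt0b.
have [kw|kw] := boolP (k \in w); last first.
  by apply: ends_weaken (miss _) _ _ => //; rewrite (negPf kw).
have jump c d : hit a b L S j (reg st' 6) (k, c, d) ->
    Q (State (update (update (reg st') 6 (hit_end a b L S j (k, c, d))) 5 0) (memory st')).
  move=> h; set t := hit_end _ _ _ _ _ _.
  have tlt : reg st' 6 < t by exact: hit_end_gt h.
  have := pending_hit h; rewrite -/t => plt.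
  exists (pending a b L S j t * n.+1 + n)%N; first by rewrite mE; nia.
  exists 0%N; split=> //; first by rewrite subn0.
    apply: (layout_setreg (st := State (update (reg st') 6 t) (memory st'))) => //.
    exact: layout_setreg.
  split=> //; split; first exact: le_trans t0 (ltW tlt).
  move=> u u0 idu; apply: hit_end_le h _ (low _ u0 idu).
  by move/idle_forP: idu; apply.
apply: (@ends_check S w st' k j _ _ _ 13 Q lay rk rj (jump _ _)) => h1.
apply: (@ends_check S w st' k j _ _ _ 9 Q lay rk rj (jump _ _)) => h2.
apply: (@ends_check S w st' k j _ _ _ 5 Q lay rk rj (jump _ _)) => h3.
apply: (@ends_check S w st' k j _ _ _ 1 Q lay rk rj (jump _ _)) => h4.
by apply: miss => _ [[l c] d] /= ->; case: c d => [] [].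
Qed.

Lemma ends_record S S' w st j : layout S w st -> reg st 4 = j%:R -> j \notin w ->
  S' j = reg st 6 -> {in predC1 j, S =1 S'} ->
  ends record st 3 (layout S' (rcons w j)).
Proof.
move=> lay rj jw S'j SS'.
apply: (@ends_seq _ _ _ 1 2); apply: ends_store.
rewrite (eval_start_cell lay rj) address_nat [eval _ _]/=.
set st1 := State _ _.
apply: (@ends_seq _ _ _ 1 1); apply: ends_store; apply: ends_setreg.
have -> : eval st1 (flag_cell rJ) = (3 + n + n + j)%:R.
  by rewrite -(eval_flag_cell lay rj).
rewrite address_nat.
have neq (x y : nat) (X : rat) f : x != y -> update f x X y = f y.
  by rewrite /update eq_sym => /negPf->.
have [l0 l1 l2 l3 lL lS lF] := lay.
split=> //=.
- by rewrite /update /= l3 size_rcons -pmulrn natr1.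
- by move=> i; rewrite !neq //; have := ltn_ord i; have := ltn_ord j; lia.
- move=> i; rewrite neq; last by have := ltn_ord i; have := ltn_ord j; lia.
  have [->|ij] := eqVneq i j; first by rewrite /update eqxx S'j.
  rewrite neq; last by rewrite !eqn_add2l eq_sym.
  by rewrite lS SS'.
- move=> i; rewrite mem_rcons inE.
  have [->|ij] := eqVneq i j; first by rewrite /update eqxx.
  rewrite neq; last by rewrite !eqn_add2l eq_sym.
  by rewrite neq ?lF //; have := ltn_ord i; have := ltn_ord j; lia.
Qed.

Definition round_cost := (2 + (n * 6).+1 + (place_cost + 3))%N.

Lemma ends_main S st : layout S [::] st ->
  ends main_loop st (n * round_cost.+1).+1
    (fun st' => exists S' w, [/\ size w = n, greedy a b L w S' & layout S' w st']).
Proof.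
move=> lay.
pose Inv m st' := exists S w, [/\ (size w + m = n)%N, greedy a b L w S & layout S w st'].
have inv0 : Inv n st by exists S, [::].
apply: ends_weaken (ends_while (U := round_cost) _ inv0) (leqnn _) _; last first.
  move=> st' [+ [m [S' [w [wm gw lay']]]]].
  rewrite eval_testLt /= (layout_k lay') (layout_n lay') ltr_nat -leqNgt => nw.
  by exists S', w; split=> //; lia.
move=> {S lay inv0} m st' [S [w [wm gw lay]]].
rewrite eval_testLt /= (layout_k lay) (layout_n lay) ltr_nat => wn.
apply: ends_seq; apply: ends_weaken (ends_select gw wn lay) (leqnn _) _.
move=> st1 [lay1 [j rj [jw jmin]]].
apply: ends_seq; apply: ends_weaken (ends_place lay1 rj) (leqnn _) _.
move=> st2 [lay2 rj2 early].
pose S' i := if i == j then reg st2 6 else S i.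
apply: ends_weaken (ends_record (S' := S') lay2 rj2 jw _ _) (leqnn _) _.
- by rewrite /S' eqxx.
- by move=> i; rewrite inE /S' => /negPf->.
move=> st3 lay3; exists m.-1; first lia.
exists S', (rcons w j); split=> //; first by rewrite size_rcons; lia.
apply: (greedy_rcons gw jw jmin); first by rewrite /S' eqxx.
by move=> i iw; rewrite /S'; case: eqP iw jw => // -> ->.
Qed.

Lemma ends_copy S w st : layout S w st -> reg st 5 = 0 ->
  ends copy_loop st (n * 3).+1 (fun st' => forall i, output st' i = S i).
Proof.
move=> lay r0.
pose Inv m st' := exists i : nat, [/\ (i + m = n)%N, reg st' 5 = i%:R, reg st' 0 = n%:R,
  forall k : 'I_n, memory st' (3 + n + k) = S k &
  forall k : 'I_n, (k < i)%N -> memory st' k = S k].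
have inv0 : Inv n st.
  by exists 0%N; split=> //; [exact: layout_n lay|exact: layout_start lay].
apply: ends_weaken (ends_while (U := 2) _ inv0) (leqnn _) _; last first.
  move=> st' [+ [m [i [_ ri rn _ out]]]].
  rewrite eval_testLt /= ri rn ltr_nat -leqNgt => ni k.
  by apply: out; apply: leq_trans ni.
move=> {lay r0 inv0} m st' [i [im ri rn stS out]].
rewrite eval_testLt /= ri rn ltr_nat => iN.
apply: (@ends_seq _ _ _ 1 1); apply: ends_store; apply: ends_setreg.
rewrite /= ri rn -!pmulrn -!natrD !address_nat.
exists m.-1; first lia.
exists i.+1; split=> //=; first lia.
- by rewrite /update /= addn1.
- move=> k; rewrite /update; case: eqP => [E|_ //].
  by have := ltn_ord k; lia.
- move=> k; rewrite ltnS leq_eqVlt => /orP[/eqP ki|ki].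
    by rewrite /update ki eqxx -ki stS.
  by rewrite /update; case: eqP ki => [->|_ ki]; rewrite ?ltnn // out.
Qed.

Lemma ends_scheduler :
  ends scheduler (initial_state a b L) (3 + ((n * round_cost.+1).+1 + (1 + (n * 3).+1)))
    (fun st => algorithm1 I (output st)).
Proof.
apply: ends_seq.
apply: (@ends_seq _ _ _ 1 2); apply: ends_setreg.
apply: (@ends_seq _ _ _ 1 1); apply: ends_setreg; apply: ends_setreg.
set st := State _ _.
(* [layout] constrains the start cells even before any job is placed, so [S0] is read off the
   memory. *)
pose S0 i : rat := memory st (3 + n + i).
have lay : layout S0 [::] st.
  split=> //=.
    by move=> i; rewrite add0n (nth_map i) ?size_enum_ord // nth_ord_enum.
  move=> i; rewrite nth_default // size_map size_enum_ord; lia.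
apply: ends_seq; apply: ends_weaken (ends_main lay) (leqnn _) _.
move=> st1 [S [w [sw gw lay1]]].
apply: ends_seq; apply: ends_setreg.
apply: ends_weaken (ends_copy (layout_setreg _ _ lay1) _) (leqnn _) _ => //.
move=> st2 out; apply: (eq_algorithm1 (S := S)); first by move=> i; rewrite out.
exact: greedy_algorithm1 sw gw.
Qed.

End Correctness.

(** * The polynomial time bound and the conclusion *)

Lemma step_count_le n :
  (3 + ((n * (round_cost n).+1).+1 + (1 + (n * 3).+1)) <= 200 * n.+1 ^ 3)%N.
(* The left-hand side equals [76 * n ^ 3 + 101 * n ^ 2 + 13 * n + 6]. *)
Proof. by rewrite /round_cost /place_cost !expnS expn0; nia. Qed.

(** This is the cost bound of [run_steps] with [m] and [s] both equal to the input size [z], with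
    [T] steps and with [M = z + T * W]. Since [n <= z], replacing [n] by [z] leaves a polynomial in
    [z] alone. *)
Lemma run_time_polynomial W : exists p : {poly nat}, forall z n, (n <= z)%N ->
  let T := (200 * n.+1 ^ 3)%N in
  (T * (1 + W * ((z + T * W) + W + 2 * z + 3)) <= p.[z])%N.
Proof.
pose T : {poly nat} := 200%N%:P * ('X + 1%N%:P) ^+ 3.
exists (T * (1%N%:P + W%:P * ('X + T * W%:P + W%:P + 2%N%:P * 'X + 3%N%:P))).
move=> z n nz /=.
have TE : T.[z] = (200 * z.+1 ^ 3)%N.
  by rewrite /T hornerCM horner_exp hornerD hornerX hornerC -[z.+1]addn1.
move: T TE => T TE; rewrite hornerM !(hornerD, hornerM, hornerX, hornerC) TE.
have : (200 * n.+1 ^ 3 <= 200 * z.+1 ^ 3)%N by rewrite leq_mul2l leq_exp2r.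
move: (200 * n.+1 ^ 3)%N (200 * z.+1 ^ 3)%N => T1 T2 T12.
by apply: leq_mul => //; rewrite leq_add2l leq_mul2l !leq_add2r leq_add2l leq_mul2r T12 !orbT.
Qed.

Theorem theorem5 :
  (exists (c : cmd) (p : {poly nat}),
     forall (n : nat) (a b : rat) (L : 'I_n -> rat),
       well_formed (uniform_instance a b L) ->
       exists (st : state) (t : nat),
         [/\ run c (initial_state a b L) st t,
             (t <= p.[input_size a b L])%N
           & algorithm1 (uniform_instance a b L) (output st)]) /\
  (forall (R : realFieldType) (n : nat) (a b : R) (L : 'I_n -> R),
     let I := uniform_instance a b L in
     well_formed I ->
     (exists S : 'I_n -> R, algorithm1 I S) /\
     (forall S : 'I_n -> R, algorithm1 I S ->
        feasible I S /\
        forall S' : 'I_n -> R, feasible I S' ->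
          sum_completion I S <= 3 * sum_completion I S')).
Proof.
split; last first.
  (* Without jobs, [well_formed] does not make [a] and [b] positive, but all claims are then
     trivial. *)
  move=> R [|n] a b L /= wf; last first.
    have [a0 b0 _] := wf ord0.
    have L0 j : 0 <= L j by have [] := wf j.
    split; first exact: algorithm1_exists.
    move=> S algS; split; first exact: algorithm1_feasible algS.
    by move=> S' fS'; apply: algorithm1_approx fS'.
  split; first by exists (fun=> 0), 1%g; split=> [[]|[]].
  move=> S _; split; first by split=> [[]|[]].
  by move=> S' _; rewrite /sum_completion !big_ord0 mulr0.
(* The program is fixed, so its weight is a constant independent of the instance. *)
have [p p_bound] := run_time_polynomial (cmd_weight scheduler).
exists scheduler, p => n a b L wf.
have [a0 b0] : ((0 < n)%N -> 0 < a) /\ ((0 < n)%N -> 0 < b).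
  by split=> n0; have [] := wf (Ordinal n0).
have [st [u [run_u u_le algS]]] := ends_scheduler L a0 b0.
have [D D0 [Dle small0]] := initial_state_small a b L.
have [_ [t run_t t_le]] := run_steps D0 Dle run_u (leqnn _) small0 (leqnn _).
exists st, t; split=> //.
apply: leq_trans t_le (leq_trans _ (p_bound _ _ (input_size_ge a b L))).
have uT := leq_trans u_le (step_count_le n).
by apply: leq_mul => //; rewrite leq_add2l leq_mul2l !leq_add2r leq_add2l leq_mul2r uT !orbT.
Qed.
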